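(* Let $\nu^{\theta}\in\mathbb C^{2n}$, $\theta=1,\ldots,2m+1$, be common eigenvectors of the matrices $A_k$, $k=1,\ldots,2m$, and let $\lambda_\theta^k$ be the eigenvalue of $A_k$ corresponding to $\nu^\theta$, i.e. $A_k\nu^\theta=\lambda^k_\theta\nu^\theta$. Then the completely solvable system $dw=X_1(w)\,dz+X_2(w)\,d\overline z$ has the $\mathbb R$-differentiable autonomous first integral $$F\colon w\to\prod_{\theta=1}^{2m+1}\bigl(\nu^{\theta}\gamma\bigr)^{h_\theta}\quad\text{for all } w\in\Omega,\qquad \Omega\subset {\rm D}(F),$$ where $\Omega$ is a domain and $h_1,\ldots,h_{2m+1}$ is a nontrivial (complex) solution of the linear system $\sum_{\theta=1}^{2m+1}\lambda_\theta^k h_\theta=0$, $k=1,\ldots,2m$.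
   Context: Let $m,n\ge 1$, $w=(w_1,\ldots,w_n)\in\mathbb C^n$, $z=(z_1,\ldots,z_m)\in\mathbb C^m$, columns. Consider $dw=X_1(w)\,dz+X_2(w)\,d\overline z$, where $X_1(w)=\|X_{\tau j}(w)\|$, $X_2(w)=\|X_{\tau,m+j}(w)\|$ ($\tau=1,\ldots,n$, $j=1,\ldots,m$) and $X_{\tau k}(w)=\sum_{\xi=1}^n\bigl(a_{\tau k\xi}w_\xi+a_{\tau k,n+\xi}\overline w_\xi\bigr)$, $k=1,\ldots,2m$, with constants $a_{\tau k\varrho}\in\mathbb C$. The associated operators are, for $j=1,\ldots,m$, $$\mathfrak x_j(w)=\sum_{\xi=1}^n\bigl(X_{\xi j}(w)\partial_{w_\xi}+\overline{X_{\xi,m+j}(w)}\,\partial_{\overline w_\xi}\bigr),\qquad \mathfrak x_{m+j}(w)=\sum_{\xi=1}^n\bigl(X_{\xi,m+j}(w)\partial_{w_\xi}+\overline{X_{\xi j}(w)}\,\partial_{\overline w_\xi}\bigr).$$ The system is assumed completely solvable: $[\mathfrak x_k,\mathfrak x_l]=0$ on $\mathbb C^n$ for all $k,l=1,\ldots,2m$. The $2n\times 2n$ matrices are given by columns: $A_j=\|a_{1j}\ldots a_{nj}\,\overline a_{1,m+j}\ldots\overline a_{n,m+j}\|$, $A_{m+j}=\|a_{1,m+j}\ldots a_{n,m+j}\,\overline a_{1j}\ldots\overline a_{nj}\|$, $j=1,\ldots,m$, where $a_{\tau k}$ is the column $(a_{\tau k1},\ldots,a_{\tau k,2n})$ and $\overline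 a_{\tau k}$ is the column $(\overline{a_{\tau k,n+1}},\ldots,\overline{a_{\tau k,2n}},\overline{a_{\tau k1}},\ldots,\overline{a_{\tau kn}})$. Complete solvability is equivalent to $A_kA_l=A_lA_k$ for all $k,l$. Put $\gamma=(w_1,\ldots,w_n,\overline w_1,\ldots,\overline w_n)$ and, for $\nu\in\mathbb C^{2n}$, $\nu\gamma=\sum_{\varrho=1}^{2n}\nu_\varrho\gamma_\varrho$. A domain is an open arcwise connected set. $\mathbb R$-differentiable means continuously differentiable as a function of the real and imaginary parts of the variables. An $\mathbb R$-differentiable $F\colon\Omega\to\mathbb C$ is an autonomous first integral if $\mathfrak x_kF(w)=0$ for all $w\in\Omega$, $k=1,\ldots,2m$. ${\rm D}(F)$ denotes the set where $F$ is defined and $\mathbb R$-differentiable (complex powers being taken as fixed smooth branches). *)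

(* Defs.v *)
From mathcomp Require Import all_boot all_order all_algebra.
From mathcomp Require Import complex.
From mathcomp Require Import all_classical all_reals all_analysis.

Set Implicit Arguments.
Unset Strict Implicit.
Unset Printing Implicit Defensive.

Import Order.TTheory GRing.Theory Num.Theory.
Import numFieldNormedType.Exports.

Local Open Scope classical_set_scope.
Local Open Scope ring_scope.
Local Open Scope complex_scope.

(* A point w = x + iy of C^n is represented by the pair (x, y), so that
   topology and differentiation on C^n are those of the real normed space
   R^n x R^n; cvec recovers the complex column. *)
Notation cspace R n := ('cV[R]_n * 'cV[R]_n)%type.

Definition cvec (R : realType) (n : nat) (w : cspace R n) : 'cV[R[i]]_n :=
  \col_xi (w.1 xi 0 +i* w.2 xi 0).

Definition arcwise_connected (R : realType) (V : topologicalType)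
    (Omega : set V) : Prop :=
  forall u v, Omega u -> Omega v ->
    exists g : R -> V,
      [/\ {within `[0, 1], continuous g}, g 0 = u, g 1 = v
        & forall t, `[0, 1]%classic t -> Omega (g t)].

Definition is_domain (R : realType) (n : nat) (Omega : set (cspace R n)) :
    Prop :=
  open Omega /\ arcwise_connected R Omega.

Section RDifferentiation.
Variables (R : realType) (n : nat).
Implicit Types (F : cspace R n -> R[i]) (Omega : set (cspace R n)).

Definition re_dir (xi : 'I_n) : cspace R n := (delta_mx xi 0, 0).
Definition im_dir (xi : 'I_n) : cspace R n := (0, delta_mx xi 0).

Definition re_part F (w : cspace R n) : R := complex.Re (F w).
Definition im_part F (w : cspace R n) : R := complex.Im (F w).

Definition dderive F (v w : cspace R n) : R[i] :=
  'D_v (re_part F) w +i* 'D_v (im_part F) w.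

Definition dx (xi : 'I_n) F (w : cspace R n) : R[i] := dderive F (re_dir xi) w.
Definition dy (xi : 'I_n) F (w : cspace R n) : R[i] := dderive F (im_dir xi) w.

Definition d_w (xi : 'I_n) F (w : cspace R n) : R[i] :=
  (dx xi F w - (0 +i* 1) * dy xi F w) / 2.
Definition d_wbar (xi : 'I_n) F (w : cspace R n) : R[i] :=
  (dx xi F w + (0 +i* 1) * dy xi F w) / 2.

(* Meaningful for open Omega: the derivatives involved are those of the total
   function F, which at interior points of Omega depend only on F on Omega. *)
Definition R_differentiable_on Omega F : Prop :=
  forall w, Omega w -> forall v,
    (exists xi, v = re_dir xi \/ v = im_dir xi) ->
    [/\ derivable (re_part F) w v, derivable (im_part F) w v,
        {for w, continuous ('D_v (re_part F))}
      & {for w, continuous ('D_v (im_part F))}].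

Definition R_differentiable2 F : Prop :=
  R_differentiable_on setT F /\
  forall xi, R_differentiable_on setT (dx xi F) /\
             R_differentiable_on setT (dy xi F).

End RDifferentiation.

(* The involution j <-> m + j of the index set {1, ..., 2m}. *)
Definition swap_half (m : nat) (k : 'I_(m + m)) : 'I_(m + m) :=
  match fintype.split k with inl j => rshift m j | inr j => lshift m j end.

Section System.
Variables (R : realType) (m n : nat).
Variable a : 'I_n -> 'I_(m + m) -> 'I_(n + n) -> R[i].
Implicit Types (F : cspace R n -> R[i]) (Omega : set (cspace R n)).

Definition Xcoef (tau : 'I_n) (k : 'I_(m + m)) (w : cspace R n) : R[i] :=
  \sum_(xi < n) (a tau k (lshift n xi) * cvec w xi 0 +
                 a tau k (rshift n xi) * conjc (cvec w xi 0)).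

(* For k = j this is x_j and for k = m + j it is x_{m+j}. *)
Definition Xop (k : 'I_(m + m)) F (w : cspace R n) : R[i] :=
  \sum_(xi < n) (Xcoef xi k w * d_w xi F w +
                 conjc (Xcoef xi (swap_half k) w) * d_wbar xi F w).

(* [x_k, x_l] = 0 as differential operators, i.e. on every C^2 function. *)
Definition completely_solvable : Prop :=
  forall k l F, R_differentiable2 F ->
    forall w, Xop k (Xop l F) w - Xop l (Xop k F) w = 0.

Definition Amx (k : 'I_(m + m)) : 'M[R[i]]_(n + n) :=
  row_mx (\matrix_(rho, tau) a tau k rho)
         (\matrix_(rho, tau) conjc (a tau (swap_half k) (swap_half rho))).

Definition autonomous_first_integral Omega F : Prop :=
  R_differentiable_on Omega F /\
  forall w, Omega w -> forall k, Xop k F w = 0.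

End System.

Section Powers.
Variables (R : realType) (n : nat).

Definition cexp (z : R[i]) : R[i] :=
  (expR (complex.Re z) * cos (complex.Im z)) +i*
  (expR (complex.Re z) * sin (complex.Im z)).

Definition gamma (w : cspace R n) : 'cV[R[i]]_(n + n) :=
  col_mx (cvec w) (map_mx conjc (cvec w)).

Definition nu_gamma (nu : 'cV[R[i]]_(n + n)) (w : cspace R n) : R[i] :=
  \sum_rho nu rho 0 * gamma w rho 0.

(* p is, around w, a smooth branch of f ^ h: where f does not vanish it is
   exp (h log f) for a smooth local logarithm of f; at a zero of f the power
   is defined only for h = 0 (value 1) and Re h > 0 (value 0). *)
Definition power_branch_at (f : cspace R n -> R[i]) (h : R[i])
    (p : cspace R n -> R[i]) (w : cspace R n) : Prop :=
  if f w == 0 then (h = 0 /\ p w = 1) \/ (0 < complex.Re h /\ p w = 0)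
  else exists (U : set (cspace R n)) (L : cspace R n -> R[i]),
    [/\ open U, U w, R_differentiable_on U L
      & forall u, U u -> cexp (L u) = f u /\ p u = cexp (h * L u)].

(* The product of the chosen branches p_theta of (nu^theta gamma)^(h_theta). *)
Definition prod_branches (N : nat) (p : 'I_N -> cspace R n -> R[i])
    (w : cspace R n) : R[i] :=
  \prod_theta p theta w.

(* The set D(F) for F the product of the p_theta. *)
Definition integral_dom (N : nat) (nu : 'I_N -> 'cV[R[i]]_(n + n))
    (h : 'cV[R[i]]_N) (p : 'I_N -> cspace R n -> R[i]) : set (cspace R n) :=
  [set w | exists U : set (cspace R n),
     [/\ open U, U w, R_differentiable_on U (prod_branches p)
       & forall u theta, U u ->
           power_branch_at (nu_gamma (nu theta)) (h theta 0) (p theta) u]].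

End Powers.

(* Main.v *)
Require Import Defs.
From mathcomp Require Import all_boot all_order all_algebra.
From mathcomp Require Import complex.
From mathcomp Require Import all_classical all_reals all_analysis.
From mathcomp Require Import ring lra.
Import Order.TTheory GRing.Theory Num.Theory.
Import numFieldNormedType.Exports.
Local Open Scope classical_set_scope.
Local Open Scope ring_scope.
Local Open Scope complex_scope.

(** Each linear form [f = nu gamma] built on a common eigenvector is a partial
    integral: applying [x_k] to it yields the linear form of [A_k nu], so
    [x_k f = lambda^k f] ([Xop_nu_gamma]).  Where no factor of
    [F = prod_theta f_theta ^ h_theta] vanishes, [F] is locally
    [exp (sum_theta h_theta L_theta)] with [exp L_theta = f_theta], and every
    directional derivative of [F] is the combination, with coefficients
    [F h_theta / f_theta], of those of the [f_theta]
    ([dderive_prod_branches]).  As [x_k] is a first-order operator without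
    constant term, [x_k F = F * sum_theta lambda_theta^k h_theta = 0] there
    ([Xop_prod_branches_eq0]).

    The set [D(F)] may contain zeros of some [f_theta], where no logarithm
    exists.  They are handled by density rather than by a discussion of the
    exponents.  Some vector [v] satisfies [f_theta v <> 0] for all [theta]
    ([common_nu_gamma_neq0]), and along the line [w + t v] every [f_theta] is
    an affine function of [t] with nonzero slope.  Hence all the [f_theta] are
    nonzero for small real [t <> 0], so that [x_k F] vanishes there; it is
    continuous because [F] is [R]-differentiable, and its value at [w] is zero
    ([Xop_prod_branches]).

    The same vector [v] gives a point around which suitable branches exist:
    on a small ball each [f_theta], after multiplication by a constant
    [cexp (- c)], takes values in the right half-plane, where the principal
    logarithm is smooth ([exists_branches]).

    Two conventions simplify the calculus.  Complex-valued functions are handled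
    through their real and imaginary parts.  Continuous differentiability is
    understood in terms of partial derivatives, together with continuity of the
    function itself: since partial derivatives are ordinary derivatives along
    lines ([is_derive_line]), the one-variable chain rule suffices, and the
    continuity makes the class stable under products and compositions without
    appeal to total differentiability. *)

Set Implicit Arguments.
Unset Strict Implicit.
Unset Printing Implicit Defensive.

(** * Continuously differentiable real functions *)

Section RealC1.
Context {R : realType} {V : normedModType R}.
Implicit Types (g : V -> R) (U D : set V) (w v : V).

(** A directional derivative is a derivative in one real variable, which gives
    access to the one-variable chain rule. *)
Lemma is_derive_line g w v dg :
  is_derive w v g dg <-> is_derive (0 : R) (1 : R) (fun t : R => g (t *: v + w)) dg.
Proof.
have E : (fun h : R => h^-1 *: ((g \o shift w) (h *: v) - g w)) =
         (fun h : R => h^-1 *: (((fun t : R => g (t *: v + w)) \o shift 0) (h *: 1) -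
           (fun t : R => g (t *: v + w)) 0)).
  apply/funext => h /=.
  by rewrite addr0 scale0r add0r /GRing.scale /= mulr1.
by split=> -[]; rewrite /derivable /derive => H1 H2; split;
  rewrite /derivable /derive ?E // -E.
Qed.

Lemma is_derive_comp1 (phi : R -> R) g w v dphi dg :
  is_derive (g w) (1 : R) phi dphi -> is_derive w v g dg ->
  is_derive w v (phi \o g) (dphi * dg).
Proof.
move=> Hphi /is_derive_line Hg; apply/is_derive_line.
apply: (@is_derive1_comp R phi (fun t => g (t *: v + w))) => //.
by rewrite scale0r add0r.
Qed.

Lemma is_derive_affine_line g w v (dg : R) :
  (forall t, g (t *: v + w) = t * dg + g w) -> is_derive w v g dg.
Proof.
move=> gl; apply/is_derive_line.
have -> : (fun t : R => g (t *: v + w)) = dg \*: id + cst (g w).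
  by apply/funext => t; rewrite gl /= mulrC.
have := is_deriveD (is_deriveZ dg (is_derive_id (0 : R) (1 : R)))
  (is_derive_cst (g w) (0 : R) (1 : R)).
by rewrite addr0 /GRing.scale /= mulr1.
Qed.

(** Partial derivatives are only asked for along the directions in [D];
    continuity of [g] is required separately because it does not follow from
    their continuity by a one-variable argument. *)
Definition C1_on D U g :=
  forall w, U w -> {for w, continuous g} /\
    forall v, D v -> derivable g w v /\ {for w, continuous ('D_v g)}.

(** On an open set a formula for the derivative holds in a neighbourhood of each
    point, so the continuity of the formula passes to the derivative. *)
Lemma C1_onI D U g (dg : V -> V -> R) : open U ->
  (forall w, U w -> {for w, continuous g}) ->
  (forall w v, U w -> D v -> is_derive w v g (dg v w)) ->
  (forall w v, U w -> D v -> {for w, continuous (dg v)}) -> C1_on D U g.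
Proof.
move=> oU gc gd dgc w Uw; split; first exact: gc.
move=> v Dv; have gwd := gd w v Uw Dv; split; first by case: gwd.
rewrite /prop_for /continuous_at (derive_val (is_derive := gwd)).
apply: cvg_trans (dgc w v Uw Dv).
apply: near_eq_cvg; have := open_nbhs_nbhs (conj oU Uw).
apply: filterS => u Uu /=; have gud := gd u v Uu Dv.
by rewrite (derive_val (is_derive := gud)).
Qed.

Lemma C1_on_is_derive D U g w v : C1_on D U g -> U w -> D v ->
  is_derive w v g ('D_v g w).
Proof. by move=> C /C[_ +] => /[apply] -[? _]; exact: derivableP. Qed.

Lemma C1_onD D U g1 g2 : open U -> C1_on D U g1 -> C1_on D U g2 ->
  C1_on D U (fun w => g1 w + g2 w).
Proof.
move=> oU C1 C2; apply: (C1_onI (dg := fun v w => 'D_v g1 w + 'D_v g2 w)) => //.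
- by move=> w Uw; apply: continuousD; [case: (C1 w Uw)|case: (C2 w Uw)].
- by move=> w v Uw Dv; apply: is_deriveD; exact: C1_on_is_derive Uw Dv.
- move=> w v Uw Dv; apply: continuousD.
    by case: (C1 w Uw) => _ /(_ v Dv)[].
  by case: (C2 w Uw) => _ /(_ v Dv)[].
Qed.

Lemma C1_onM D U g1 g2 : open U -> C1_on D U g1 -> C1_on D U g2 ->
  C1_on D U (fun w => g1 w * g2 w).
Proof.
move=> oU C1 C2.
apply: (C1_onI (dg := fun v w => g1 w * 'D_v g2 w + g2 w * 'D_v g1 w)) => //.
- by move=> w Uw; apply: continuousM; [case: (C1 w Uw)|case: (C2 w Uw)].
- by move=> w v Uw Dv; apply: is_deriveM; exact: C1_on_is_derive Uw Dv.
- move=> w v Uw Dv.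
  case: (C1 w Uw) (C2 w Uw) => c1 /(_ v Dv)[_ d1] [c2 /(_ v Dv)[_ d2]].
  by apply: continuousD; apply: continuousM.
Qed.

Lemma C1_on_cst D U c : open U -> C1_on D U (fun=> c).
Proof.
move=> oU; apply: (C1_onI (dg := fun v w => 0)) => //.
- by move=> w _; exact: cst_continuous.
- by move=> w v _ _; exact: cst_continuous.
Qed.

Lemma C1_on_comp D U (phi dphi : R -> R) g : open U -> C1_on D U g ->
  (forall w, U w -> is_derive (g w) (1 : R) phi (dphi (g w))) ->
  (forall w, U w -> {for g w, continuous dphi}) ->
  C1_on D U (fun w => phi (g w)).
Proof.
move=> oU C phid dphic.
apply: (C1_onI (dg := fun v w => dphi (g w) * 'D_v g w)) => //.
- move=> w Uw; apply: continuous_comp; first by case: (C w Uw).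
  apply: differentiable_continuous; apply/derivable1_diffP.
  by case: (phid w Uw).
- move=> w v Uw Dv; apply: is_derive_comp1; first exact: phid.
  exact: C1_on_is_derive Uw Dv.
- move=> w v Uw Dv; case: (C w Uw) => c /(_ v Dv)[_ d].
  by apply: continuousM => //; apply: continuous_comp => //; exact: dphic.
Qed.

Lemma C1_on_linear D U g (dg : V -> R) : open U ->
  (forall w, {for w, continuous g}) ->
  (forall t v w, g (t *: v + w) = t * dg v + g w) -> C1_on D U g.
Proof.
move=> oU gc gl; apply: (C1_onI (dg := fun v _ => dg v)) => //.
- by move=> w v _ _; exact: is_derive_affine_line.
- by move=> w v _ _; exact: cst_continuous.
Qed.

Lemma cvg_line v w : t *: v + w @[t --> (0 : R)^'] --> w.
Proof.
have : t *: v + w @[t --> (0 : R)^'] --> (0 : R) *: v + w.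
  apply: cvgD; last exact: cvg_cst.
  by apply: cvgZr_tmp; exact: cvg_within.
by rewrite scale0r add0r.
Qed.

(** Vanishing on a punctured segment ending at [w] is enough for a continuous
    function to vanish at [w]: the form of density used for the zeros of the
    factors. *)
Lemma continuous_eq0_line g w v :
  {for w, continuous g} -> (\forall t \near (0 : R)^', g (t *: v + w) = 0) ->
  g w = 0.
Proof.
move=> gc g0.
have H1 : g (t *: v + w) @[t --> (0 : R)^'] --> g w.
  apply: (@cvg_comp _ _ _ (fun t : R => t *: v + w) g _ (nbhs w)) => //.
  exact: cvg_line.
have H2 : g (t *: v + w) @[t --> (0 : R)^'] --> (0 : R).
  by apply: cvg_near_cst; exact: g0.
exact: (cvg_unique (@norm_hausdorff _ _) H1 H2).
Qed.

End RealC1.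

(** * The complex exponential and the principal logarithm *)

Section ComplexFacts.
Context {R : realType}.
Implicit Types x y z : R[i].

Lemma cReD x y : complex.Re (x + y) = complex.Re x + complex.Re y.
Proof. by case: x; case: y. Qed.
Lemma cImD x y : complex.Im (x + y) = complex.Im x + complex.Im y.
Proof. by case: x; case: y. Qed.
Lemma cReM x y : complex.Re (x * y) =
  complex.Re x * complex.Re y - complex.Im x * complex.Im y.
Proof. by case: x; case: y. Qed.
Lemma cImM x y : complex.Im (x * y) =
  complex.Re x * complex.Im y + complex.Im x * complex.Re y.
Proof. by case: x; case: y. Qed.
Lemma complex_eqP x y :
  complex.Re x = complex.Re y -> complex.Im x = complex.Im y -> x = y.
Proof. by case: x; case: y => ? ? ? ? /= -> ->. Qed.

Lemma cexpD x y : cexp (x + y) = cexp x * cexp y.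
Proof.
apply: complex_eqP; rewrite ?cReM ?cImM /= cReD cImD expRD ?cosD ?sinD; ring.
Qed.

Lemma cexp0 : cexp 0 = 1 :> R[i].
Proof. by apply: complex_eqP => /=; rewrite expR0 ?cos0 ?sin0 !mul1r. Qed.

Lemma cexp_sum (I : Type) (s : seq I) (F : I -> R[i]) :
  cexp (\sum_(i <- s) F i) = \prod_(i <- s) cexp (F i).
Proof. exact: (big_morph _ cexpD cexp0). Qed.

Lemma cexp_neq0 z : cexp z != 0.
Proof.
apply/eqP => E; have /eqP := oner_neq0 R[i]; apply.
by rewrite -cexp0 -[in LHS](addrN z) cexpD E mul0r.
Qed.

(** The principal logarithm on the right half-plane.  Writing [ln |z|] as
    [ln (Re z) - ln (cos (arg z))] avoids square roots and keeps only
    functions with known derivatives. *)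
Definition plog z : R[i] :=
  (ln (complex.Re z) - ln (cos (atan (complex.Im z / complex.Re z)))) +i*
  atan (complex.Im z / complex.Re z).

Lemma cos_atan_gt0 (x : R) : 0 < cos (atan x).
Proof. by apply: cos_gt0_pihalf; rewrite atan_gtNpi2 atan_ltpi2. Qed.

Lemma cexp_plog z : 0 < complex.Re z -> cexp (plog z) = z.
Proof.
case: z => x y /= x0; rewrite /cexp /plog /=.
set t := atan _; have t0 : 0 < cos t := cos_atan_gt0 _.
have E : sin t = cos t * (y / x).
  by rewrite -[y / x]atanK -/t /tan mulrCA mulfV ?mulr1 ?gt_eqF.
by rewrite expRD expRN !lnK ?posrE // E; congr (_ +i* _); field;
  rewrite ?gt_eqF.
Qed.

(** The four open half-planes bounded by the axes cover the nonzero numbers, and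
    a rotation by a multiple of a quarter-turn maps each of them to the right one. *)
Lemma cexp_rotate z : z != 0 -> exists c, 0 < complex.Re (cexp (- c) * z).
Proof.
case: z => x y; rewrite eq_complex /= negb_and => xy.
have [x0|x0|x0] := ltgtP x 0.
- exists (0 +i* pi); rewrite /= oppr0 expR0 cosN sinN cospi sinpi; lra.
- exists 0; rewrite /= oppr0 expR0 cos0 sin0; lra.
- move: xy; rewrite x0 eqxx /= => y0; have [y1|y1|y1] := ltgtP y 0.
  + exists (0 +i* - (pi / 2)); rewrite /= oppr0 expR0 opprK cos_pihalf sin_pihalf; lra.
  + exists (0 +i* (pi / 2)); rewrite /= oppr0 expR0 cosN sinN cos_pihalf sin_pihalf; lra.
  + by rewrite y1 eqxx in y0.
Qed.

End ComplexFacts.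

(** * Calculus of complex-valued functions on C^n *)

Section ComplexC1.
Context {R : realType} {n : nat}.
Implicit Types (F G L : cspace R n -> R[i]) (U : set (cspace R n)) (w v : cspace R n).

Definition coord_dir : set (cspace R n) :=
  [set v | exists xi, v = re_dir R xi \/ v = im_dir R xi].

Definition is_cderive w v F (dF : R[i]) :=
  is_derive w v (re_part F) (complex.Re dF) /\
  is_derive w v (im_part F) (complex.Im dF).

Definition cC1_on U F :=
  C1_on coord_dir U (re_part F) /\ C1_on coord_dir U (im_part F).

Lemma is_cderiveE w v F dF : is_cderive w v F dF -> dderive F v w = dF.
Proof. by case: dF => a b [[_ /= E1] [_ /= E2]]; rewrite /dderive E1 E2. Qed.

Lemma R_differentiable_cderive U F w v : R_differentiable_on U F -> U w ->
  coord_dir v -> is_cderive w v F (dderive F v w).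
Proof. by move=> D Uw /(D w Uw)[d1 d2 _ _]; split; exact: derivableP. Qed.

Lemma cC1_on_R_differentiable U F : cC1_on U F -> R_differentiable_on U F.
Proof.
move=> [C1 C2] w Uw v Dv; have [_ /(_ v Dv)[d1 c1]] := C1 w Uw.
by have [_ /(_ v Dv)[d2 c2]] := C2 w Uw; exact: And4 d1 d2 c1 c2.
Qed.

Lemma near_is_cderive w v F G dF : (\near w, F w = G w) ->
  is_cderive w v F dF -> is_cderive w v G dF.
Proof.
move=> FG [d1 d2]; split; [apply: near_eq_is_derive d1|apply: near_eq_is_derive d2];
  by near=> u; rewrite /re_part /im_part;
    congr (complex.Re _) || congr (complex.Im _); near: u.
Unshelve. all: by end_near. Qed.

Lemma is_cderiveD w v F G dF dG : is_cderive w v F dF -> is_cderive w v G dG ->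
  is_cderive w v (fun u => F u + G u) (dF + dG).
Proof.
move=> [f1 f2] [g1 g2]; split; rewrite ?cReD ?cImD.
- rewrite (_ : re_part _ = re_part F + re_part G); first exact: is_deriveD.
  by apply/funext => u; rewrite /re_part cReD.
- rewrite (_ : im_part _ = im_part F + im_part G); first exact: is_deriveD.
  by apply/funext => u; rewrite /im_part cImD.
Qed.

Lemma is_cderive_cst w v c : is_cderive w v (fun=> c) 0.
Proof.
by split;
  [exact: (is_derive_cst (complex.Re c))|exact: (is_derive_cst (complex.Im c))].
Qed.

Lemma is_cderive_sum (I : Type) (s : seq I) w v (F : I -> cspace R n -> R[i]) dF :
  (forall i, is_cderive w v (F i) (dF i)) ->
  is_cderive w v (fun u => \sum_(i <- s) F i u) (\sum_(i <- s) dF i).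
Proof.
move=> H; elim: s => [|i s IH].
  under [X in is_cderive _ _ X _]funext do rewrite big_nil.
  by rewrite big_nil; exact: is_cderive_cst.
under [X in is_cderive _ _ X _]funext do rewrite big_cons.
by rewrite big_cons; exact: is_cderiveD.
Qed.

Lemma is_cderiveZ w v c F dF : is_cderive w v F dF ->
  is_cderive w v (fun u => c * F u) (c * dF).
Proof.
move=> [f1 f2]; split.
- rewrite (_ : re_part _ = (complex.Re c \*: re_part F - complex.Im c \*: im_part F)).
    by rewrite cReM; apply: is_deriveB; exact: is_deriveZ.
  by apply/funext => u; rewrite /re_part cReM.
- rewrite (_ : im_part _ = (complex.Re c \*: im_part F + complex.Im c \*: re_part F)).
    by rewrite cImM; apply: is_deriveD; exact: is_deriveZ.
  by apply/funext => u; rewrite /im_part cImM.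
Qed.

(** The complex chain rule for [exp], which comes down to [exp' = exp] and to
    the derivatives of [cos] and [sin]. *)
Lemma is_cderive_cexp w v L dL : is_cderive w v L dL ->
  is_cderive w v (fun u => cexp (L u)) (cexp (L w) * dL).
Proof.
move=> [f1 f2].
have e1 := is_derive_comp1 (is_derive_expR _) f1.
have c1 := is_derive_comp1 (is_derive_cos _) f2.
have s1 := is_derive_comp1 (is_derive_sin _) f2.
split.
- rewrite cReM (_ : re_part _ = (expR \o re_part L) * (cos \o im_part L)) //.
  refine (is_derive_eq (is_deriveM e1 c1) _).
  by rewrite /GRing.scale /= /re_part /im_part; ring.
- rewrite cImM (_ : im_part _ = (expR \o re_part L) * (sin \o im_part L)) //.
  refine (is_derive_eq (is_deriveM e1 s1) _).
  by rewrite /GRing.scale /= /re_part /im_part; ring.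
Qed.

Lemma cC1_onD U F G : open U -> cC1_on U F -> cC1_on U G ->
  cC1_on U (fun w => F w + G w).
Proof.
move=> oU [f1 f2] [g1 g2]; split.
- rewrite (_ : re_part _ = fun w => re_part F w + re_part G w).
    exact: (C1_onD oU f1 g1).
  by apply/funext => u; rewrite /re_part cReD.
- rewrite (_ : im_part _ = fun w => im_part F w + im_part G w).
    exact: (C1_onD oU f2 g2).
  by apply/funext => u; rewrite /im_part cImD.
Qed.

Lemma cC1_onM U F G : open U -> cC1_on U F -> cC1_on U G ->
  cC1_on U (fun w => F w * G w).
Proof.
move=> oU [f1 f2] [g1 g2]; split.
- rewrite (_ : re_part _ = fun w => re_part F w * re_part G w +
    (-1) * (im_part F w * im_part G w)).
    apply: (C1_onD oU (C1_onM oU f1 g1)).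
    exact: (C1_onM oU (C1_on_cst _ (-1) oU) (C1_onM oU f2 g2)).
  by apply/funext => u; rewrite /re_part cReM mulN1r.
- rewrite (_ : im_part _ = fun w => re_part F w * im_part G w +
    im_part F w * re_part G w).
    exact: (C1_onD oU (C1_onM oU f1 g2) (C1_onM oU f2 g1)).
  by apply/funext => u; rewrite /im_part cImM.
Qed.

Lemma cC1_on_cst U c : open U -> cC1_on U (fun=> c).
Proof.
by move=> oU; split;
  [exact: (C1_on_cst _ (complex.Re c) oU)|exact: (C1_on_cst _ (complex.Im c) oU)].
Qed.

Lemma cC1_on_sum (I : Type) (s : seq I) U (F : I -> cspace R n -> R[i]) :
  open U -> (forall i, cC1_on U (F i)) -> cC1_on U (fun w => \sum_(i <- s) F i w).
Proof.
move=> oU H; elim: s => [|i s IH].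
  under [X in cC1_on _ X]funext do rewrite big_nil.
  exact: (cC1_on_cst 0 oU).
under [X in cC1_on _ X]funext do rewrite big_cons.
exact: (cC1_onD oU (H i) IH).
Qed.

Lemma cC1_on_prod (I : Type) (s : seq I) U (F : I -> cspace R n -> R[i]) :
  open U -> (forall i, cC1_on U (F i)) -> cC1_on U (fun w => \prod_(i <- s) F i w).
Proof.
move=> oU H; elim: s => [|i s IH].
  under [X in cC1_on _ X]funext do rewrite big_nil.
  exact: (cC1_on_cst 1 oU).
under [X in cC1_on _ X]funext do rewrite big_cons.
exact: (cC1_onM oU (H i) IH).
Qed.

Lemma continuousNsin (x : R) : {for x, continuous (fun y : R => - sin y)}.
Proof. by apply: continuousN; exact: continuous_sin. Qed.

Lemma cC1_on_cexp U L : open U -> cC1_on U L -> cC1_on U (fun w => cexp (L w)).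
Proof.
move=> oU [l1 l2].
have e1 : C1_on coord_dir U (fun w => expR (re_part L w)).
  exact: (C1_on_comp oU l1 (fun w _ => is_derive_expR (re_part L w))
    (fun w _ => @continuous_expR R (re_part L w))).
split.
- exact: (C1_onM oU e1 (C1_on_comp oU l2
    (fun w _ => is_derive_cos (im_part L w))
    (fun w _ => @continuousNsin (im_part L w)))).
- exact: (C1_onM oU e1 (C1_on_comp oU l2
    (fun w _ => is_derive_sin (im_part L w))
    (fun w _ => @continuous_cos R (im_part L w)))).
Qed.

Lemma cC1_on_plog U F : open U -> (forall w, U w -> 0 < complex.Re (F w)) ->
  cC1_on U F -> cC1_on U (fun w => plog (F w)).
Proof.
move=> oU F0 [f1 f2].
have i1 : C1_on coord_dir U (fun w => (re_part F w)^-1).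
  apply: (C1_on_comp (phi := GRing.inv) (dphi := fun x => - x ^- 2) oU f1) => w /F0 Fw.
  - have rw0 : re_part F w != 0 by rewrite gt_eqF.
    refine (is_derive_eq (@is_deriveV R id _ _ _ rw0 (is_derive_id _ _)) _).
    by rewrite /GRing.scale /= mulr1.
  - apply: continuousN; apply: continuousV; first by rewrite expf_neq0// gt_eqF.
    exact: exprn_continuous.
have t1 : C1_on coord_dir U (fun w => atan (im_part F w / re_part F w)).
  apply: (C1_on_comp (phi := atan) (dphi := fun x => (1 + x ^+ 2)^-1) oU
    (C1_onM oU f2 i1)).
  move=> w Uw; apply: continuousV.
    by rewrite gt_eqF// ltr_wpDr// sqr_ge0.
  apply: continuousD; first exact: cst_continuous.
  exact: exprn_continuous.
have ln1 g : C1_on coord_dir U g -> (forall w, U w -> 0 < g w) ->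
    C1_on coord_dir U (fun w => ln (g w)).
  move=> gC g0.
  apply: (C1_on_comp (phi := @ln R) (dphi := GRing.inv) oU gC) => w /g0 gw.
    exact: is_derive1_ln.
  by apply: inv_continuous; rewrite gt_eqF.
split; last exact: t1.
rewrite (_ : re_part _ = fun w => ln (re_part F w) +
  (-1) * ln (cos (atan (im_part F w / re_part F w)))); last first.
  by apply/funext => w; rewrite mulN1r.
apply: (C1_onD oU (ln1 _ f1 F0)); apply: (C1_onM oU (C1_on_cst _ (-1) oU)).
apply: ln1; last by move=> w _; exact: cos_atan_gt0.
exact: (C1_on_comp oU t1 (fun w _ => is_derive_cos _)
  (fun w _ => @continuousNsin _)).
Qed.

End ComplexC1.
(** * The linear forms nu gamma *)

Section LinearForms.
Context {R : realType} {n : nat}.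
Implicit Types (nu : 'cV[R[i]]_(n + n)) (w v : cspace R n) (U : set (cspace R n)).

Lemma gamma_lshift w xi : gamma w (lshift n xi) 0 = w.1 xi 0 +i* w.2 xi 0.
Proof. by rewrite /gamma col_mxEu mxE. Qed.

Lemma gamma_rshift w xi : gamma w (rshift n xi) 0 = w.1 xi 0 +i* - w.2 xi 0.
Proof. by rewrite /gamma col_mxEd !mxE. Qed.

Lemma gamma_line (t : R) v w rho :
  gamma (t *: v + w) rho 0 = t%:C * gamma v rho 0 + gamma w rho 0.
Proof.
rewrite -(splitK rho); case: (fintype.split rho) => xi /=.
  by rewrite !gamma_lshift !mxE; apply: complex_eqP;
    rewrite ?cReD ?cImD ?cReM ?cImM /=; ring.
by rewrite !gamma_rshift !mxE; apply: complex_eqP;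
  rewrite ?cReD ?cImD ?cReM ?cImM /=; ring.
Qed.

Lemma nu_gamma_line nu (t : R) v w :
  nu_gamma nu (t *: v + w) = t%:C * nu_gamma nu v + nu_gamma nu w.
Proof.
rewrite /nu_gamma mulr_sumr -big_split; apply: eq_bigr => rho _ /=.
by rewrite gamma_line; ring.
Qed.

Lemma is_cderive_nu_gamma nu w v : is_cderive w v (nu_gamma nu) (nu_gamma nu v).
Proof.
by split; apply: is_derive_affine_line => t;
  rewrite /re_part /im_part nu_gamma_line ?cReD ?cImD ?cReM ?cImM /= mul0r ?subr0 ?addr0.
Qed.

Lemma nu_gamma_re_dir nu xi :
  nu_gamma nu (re_dir R xi) = nu (lshift n xi) 0 + nu (rshift n xi) 0.
Proof.
rewrite /nu_gamma big_split_ord /= (bigD1 xi) //= [X in _ + X](bigD1 xi) //=.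
rewrite !big1 ?addr0 ?gamma_lshift ?gamma_rshift /= ?mxE ?eqxx /= ?oppr0 ?mulr1 //.
  by move=> j jx; rewrite gamma_rshift /= !mxE (negPf jx) /= oppr0 mulr0.
by move=> j jx; rewrite gamma_lshift /= !mxE (negPf jx) /= mulr0.
Qed.

Lemma nu_gamma_im_dir nu xi : nu_gamma nu (im_dir R xi) =
  (0 +i* 1) * (nu (lshift n xi) 0 - nu (rshift n xi) 0).
Proof.
rewrite /nu_gamma big_split_ord /= (bigD1 xi) //= [X in _ + X](bigD1 xi) //=.
rewrite !big1 ?addr0 ?gamma_lshift ?gamma_rshift /= ?mxE ?eqxx /=; first last.
- by move=> j jx; rewrite gamma_lshift /= !mxE (negPf jx) /= mulr0.
- by move=> j jx; rewrite gamma_rshift /= !mxE (negPf jx) /= oppr0 mulr0.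
by apply: complex_eqP; rewrite ?cReD ?cImD ?cReM ?cImM /= ?cReD ?cImD /=;
   case: (nu (lshift n xi) 0); case: (nu (rshift n xi) 0) => a b c d /=; ring.
Qed.

(** The coordinates of [nu] can be recovered from the values of the form at the
    real and imaginary coordinate directions, although the form is only
    linear over the reals. *)
Lemma nu_gamma_neq0 nu : nu != 0 -> exists v, nu_gamma nu v != 0.
Proof.
move=> nu0; apply: contrapT => H.
have Z v : nu_gamma nu v = 0.
  by apply: contrapT => /eqP vn; apply: H; exists v.
have i0 : (0 +i* 1 : R[i]) != 0 by rewrite eq_complex /= oner_eq0 andbF.
have E xi : nu (lshift n xi) 0 = nu (rshift n xi) 0.
  apply/eqP; rewrite -subr_eq0.
  have /eqP := Z (im_dir R xi).
  by rewrite nu_gamma_im_dir mulf_eq0 (negPf i0).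
have E2 xi : nu (rshift n xi) 0 = 0.
  have /eqP := Z (re_dir R xi).
  by rewrite nu_gamma_re_dir E -mulr2n mulrn_eq0 /= => /eqP.
case/eqP: nu0; apply/matrixP => rho j; rewrite ord1 mxE.
by rewrite -(splitK rho); case: (fintype.split rho) => xi /=; rewrite ?E E2.
Qed.

Lemma continuous_coord_fst xi : continuous (fun w : cspace R n => w.1 xi 0).
Proof.
move=> w; apply: (@continuous_comp _ _ _ fst (fun M : 'cV[R]_n => M xi 0)).
  exact: cvg_fst.
exact: coord_continuous.
Qed.

Lemma continuous_coord_snd xi : continuous (fun w : cspace R n => w.2 xi 0).
Proof.
move=> w; apply: (@continuous_comp _ _ _ snd (fun M : 'cV[R]_n => M xi 0)).
  exact: cvg_snd.
exact: coord_continuous.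
Qed.

Lemma cC1_on_gamma U rho : open U -> cC1_on U (fun w : cspace R n => gamma w rho 0).
Proof.
move=> oU.
have C1 xi : C1_on coord_dir U (fun w : cspace R n => w.1 xi 0).
  refine (C1_on_linear (g := fun v : cspace R n => v.1 xi 0)
    (dg := fun v : cspace R n => v.1 xi 0) _ oU _ _) => [w|t v w].
    exact: continuous_coord_fst.
  by rewrite !mxE.
have C2 xi : C1_on coord_dir U (fun w : cspace R n => w.2 xi 0).
  refine (C1_on_linear (g := fun v : cspace R n => v.2 xi 0)
    (dg := fun v : cspace R n => v.2 xi 0) _ oU _ _) => [w|t v w].
    exact: continuous_coord_snd.
  by rewrite !mxE.
rewrite -(splitK rho); case: (fintype.split rho) => xi /=.
  under [X in cC1_on _ X]funext do rewrite gamma_lshift.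
  by split; [exact: C1|exact: C2].
under [X in cC1_on _ X]funext do rewrite gamma_rshift.
split; first exact: C1.
rewrite (_ : im_part _ = fun w => (-1) * w.2 xi 0); last first.
  by apply/funext => w; rewrite mulN1r.
exact: (C1_onM oU (C1_on_cst _ (-1) oU) (C2 xi)).
Qed.

Lemma cC1_on_nu_gamma U nu : open U -> cC1_on U (nu_gamma nu).
Proof.
move=> oU; apply: (cC1_on_sum _ oU) => rho.
exact: (cC1_onM oU (cC1_on_cst _ oU) (cC1_on_gamma rho oU)).
Qed.

Lemma near0_affine_neq0_real (x y : R) : (x != 0) || (y != 0) ->
  \forall t \near (0 : R)^', t * y + x != 0.
Proof.
have [-> /= y0|x0 _] := eqVneq x 0.
  near=> t; rewrite addr0 mulf_neq0 //; near: t; exact: nbhs_dnbhs_neq.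
have y1 : 0 < `|y| + 1 by rewrite ltr_wpDl.
near=> t.
apply/eqP => /eqP; rewrite addr_eq0 => /eqP E.
have : `|t| < `|x| / (`|y| + 1).
  by near: t; apply: dnbhs0_lt; rewrite divr_gt0 // normr_gt0.
rewrite ltr_pdivlMr // -[`|x|]normrN -E normrM mulrDr mulr1.
by rewrite gtrDl normr_lt0.
Unshelve. all: by end_near. Qed.

Lemma near0_affine_neq0 (x y : R[i]) : (x != 0) || (y != 0) ->
  \forall t \near (0 : R)^', t%:C * y + x != 0.
Proof.
move=> xy.
have : ((complex.Re x != 0) || (complex.Re y != 0)) ||
       ((complex.Im x != 0) || (complex.Im y != 0)).
  move: xy; rewrite !eq_complex /=.
  by case: eqP; case: eqP; case: eqP; case: eqP.
case/orP => /near0_affine_neq0_real; apply: filterS => t; apply: contraNN => /eqP E.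
  by have := congr1 (@complex.Re R) E; rewrite cReD cReM /= mul0r subr0 => ->.
by have := congr1 (@complex.Im R) E; rewrite cImD cImM /= mul0r addr0 => ->.
Qed.

(** Along a line in a direction where no form vanishes, each form is an affine
    function of the parameter with at most one zero. *)
Lemma near0_nu_gamma_neq0 (I : finType) (nu : I -> 'cV[R[i]]_(n + n)) v w :
  (forall i, nu_gamma (nu i) v != 0) ->
  \forall t \near (0 : R)^', forall i, nu_gamma (nu i) (t *: v + w) != 0.
Proof.
move=> H; apply: filter_forall => i.
have : (nu_gamma (nu i) w != 0) || (nu_gamma (nu i) v != 0) by rewrite H orbT.
by move=> /near0_affine_neq0; apply: filterS => t; rewrite nu_gamma_line.
Qed.

(** Induction on the family: a vector good for the first forms is perturbed in
    a direction where the new form does not vanish; a small perturbation keeps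
    the previous values nonzero. *)
Lemma common_nu_gamma_neq0 (I : finType) (nu : I -> 'cV[R[i]]_(n + n)) :
  (forall i, nu i != 0) -> exists v, forall i, nu_gamma (nu i) v != 0.
Proof.
move=> nu0.
suff H (s : seq I) : exists v, forall i, i \in s -> nu_gamma (nu i) v != 0.
  by have [v Hv] := H (enum I); exists v => i; apply: Hv; rewrite mem_enum.
elim: s => [|j s [v0 Hv0]]; first by exists 0.
have [u ju] := nu_gamma_neq0 (nu0 j).
have : \forall t \near (0 : R)^', forall i, i \in j :: s ->
    nu_gamma (nu i) (t *: u + v0) != 0.
  apply: filter_forall => i; have [ijs|_] := boolP (i \in j :: s); last exact: nearW.
  have : (nu_gamma (nu i) v0 != 0) || (nu_gamma (nu i) u != 0).
    by move: ijs; rewrite inE => /orP[/eqP->|/Hv0->//]; rewrite ju orbT.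
  by move=> /near0_affine_neq0; apply: filterS => t; rewrite nu_gamma_line.
by move=> /filter_ex[t Ht]; exists (t *: u + v0).
Qed.

End LinearForms.
(** * The operators x_k *)

Section Operators.
Context {R : realType} {m n : nat}.
Variable a : 'I_n -> 'I_(m + m) -> 'I_(n + n) -> R[i].
Implicit Types (F G : cspace R n -> R[i]) (w v : cspace R n) (U : set (cspace R n)).

(** An operator [x_k] is a pointwise combination of the partial derivatives, so a
    linear relation between gradients at a single point transfers to [x_k]. *)
Lemma Xop_dderive_sum (I : finType) F (G : I -> cspace R n -> R[i]) (c : I -> R[i]) k w :
  (forall v, coord_dir v -> dderive F v w = \sum_i c i * dderive (G i) v w) ->
  Xop a k F w = \sum_i c i * Xop a k (G i) w.
Proof.
move=> H; rewrite /Xop; under [RHS]eq_bigr do rewrite mulr_sumr.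
rewrite exchange_big; apply: eq_bigr => xi _ /=.
rewrite /d_w /d_wbar /dx /dy !H; [|by exists xi; right|by exists xi; left].
rewrite mulr_sumr -sumrB -big_split /=.
move: (Xcoef a xi k w) (conjc _) => x y; rewrite !mulr_suml !mulr_sumr -big_split /=.
apply: eq_bigr => i _.
move: (c i) (dderive (G i) _ w) (dderive (G i) _ w) => ci dxi dyi.
by ring.
Qed.

Lemma d_w_nu_gamma (nu : 'cV[R[i]]_(n + n)) xi w :
  d_w xi (nu_gamma nu) w = nu (lshift n xi) 0.
Proof.
rewrite /d_w /dx /dy !(is_cderiveE (is_cderive_nu_gamma _ _ _)).
rewrite nu_gamma_re_dir nu_gamma_im_dir mulrA.
have -> : (0 +i* 1) * (0 +i* 1) = -1 :> R[i] by exact: sqr_i.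
by field.
Qed.

Lemma d_wbar_nu_gamma (nu : 'cV[R[i]]_(n + n)) xi w :
  d_wbar xi (nu_gamma nu) w = nu (rshift n xi) 0.
Proof.
rewrite /d_wbar /dx /dy !(is_cderiveE (is_cderive_nu_gamma _ _ _)).
rewrite nu_gamma_re_dir nu_gamma_im_dir mulrA.
have -> : (0 +i* 1) * (0 +i* 1) = -1 :> R[i] by exact: sqr_i.
by field.
Qed.

Lemma swap_half_lshift p (j : 'I_p) : swap_half (lshift p j) = rshift p j.
Proof. by rewrite /swap_half (unsplitK (inl j)). Qed.

Lemma swap_half_rshift p (j : 'I_p) : swap_half (rshift p j) = lshift p j.
Proof. by rewrite /swap_half (unsplitK (inr j)). Qed.

(** Exchanging the halves of [gamma] amounts to conjugation, since its two
    blocks are [w] and the conjugate of [w]. *)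
Lemma conj_gamma w rho : conjc (gamma w (swap_half rho) 0) = gamma w rho 0.
Proof.
rewrite -(splitK rho); case: (fintype.split rho) => xi /=.
  by rewrite swap_half_lshift gamma_rshift gamma_lshift /= opprK.
by rewrite swap_half_rshift gamma_rshift gamma_lshift.
Qed.

Lemma XcoefE tau k w : Xcoef a tau k w = \sum_rho a tau k rho * gamma w rho 0.
Proof.
rewrite /Xcoef [RHS]big_split_ord /= -big_split; apply: eq_bigr => xi _ /=.
by rewrite gamma_lshift gamma_rshift /cvec mxE.
Qed.

Lemma conj_XcoefE tau k w : conjc (Xcoef a tau k w) =
  \sum_rho conjc (a tau k (swap_half rho)) * gamma w rho 0.
Proof.
rewrite XcoefE rmorph_sum /= (reindex_inj (h := @swap_half n)) /=.
  by apply: eq_bigr => rho _; rewrite rmorphM /= conj_gamma.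
apply: (can_inj (g := @swap_half n)) => rho.
rewrite -(splitK rho); case: (fintype.split rho) => xi /=.
  by rewrite swap_half_lshift swap_half_rshift.
by rewrite swap_half_rshift swap_half_lshift.
Qed.

(** The reason for the definition of [A_k]: its columns are the coefficients of
    the linear vector field [x_k] in the variables [gamma], so [x_k] acts on
    linear forms as [A_k] acts on their coefficient vectors. *)
Lemma Xop_nu_gamma (nu : 'cV[R[i]]_(n + n)) k w :
  Xop a k (nu_gamma nu) w = nu_gamma (Amx a k *m nu) w.
Proof.
transitivity (\sum_rho \sum_xi
   (a xi k rho * nu (lshift n xi) 0 +
    conjc (a xi (swap_half k) (swap_half rho)) * nu (rshift n xi) 0) * gamma w rho 0).
  rewrite exchange_big; apply: eq_bigr => xi _ /=.
  rewrite d_w_nu_gamma d_wbar_nu_gamma XcoefE conj_XcoefE !mulr_suml -big_split /=.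
  by apply: eq_bigr => rho _; ring.
apply: eq_bigr => rho _; rewrite -mulr_suml; congr (_ * _).
rewrite mxE big_split_ord /= -big_split; apply: eq_bigr => xi _ /=.
by rewrite /Amx row_mxEl row_mxEr !mxE.
Qed.

Definition ccont w F :=
  {for w, continuous (re_part F)} /\ {for w, continuous (im_part F)}.

Lemma ccontD w F G : ccont w F -> ccont w G -> ccont w (fun u => F u + G u).
Proof.
move=> [f1 f2] [g1 g2]; split.
- rewrite (_ : re_part _ = fun u => re_part F u + re_part G u).
    exact: continuousD f1 g1.
  by apply/funext => u; rewrite /re_part cReD.
- rewrite (_ : im_part _ = fun u => im_part F u + im_part G u).
    exact: continuousD f2 g2.
  by apply/funext => u; rewrite /im_part cImD.
Qed.

Lemma ccontM w F G : ccont w F -> ccont w G -> ccont w (fun u => F u * G u).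
Proof.
move=> [f1 f2] [g1 g2]; split.
- rewrite (_ : re_part _ = fun u => re_part F u * re_part G u -
    im_part F u * im_part G u).
    exact: continuousB (continuousM f1 g1) (continuousM f2 g2).
  by apply/funext => u; rewrite /re_part cReM.
- rewrite (_ : im_part _ = fun u => re_part F u * im_part G u + im_part F u * re_part G u).
    exact: continuousD (continuousM f1 g2) (continuousM f2 g1).
  by apply/funext => u; rewrite /im_part cImM.
Qed.

Lemma ccont_cst w c : ccont w (fun=> c).
Proof. by split; exact: cst_continuous. Qed.

Lemma ccont_sum (I : Type) (s : seq I) w (F : I -> cspace R n -> R[i]) :
  (forall i, ccont w (F i)) -> ccont w (fun u => \sum_(i <- s) F i u).
Proof.
move=> H; elim: s => [|i s IH].
  under [X in ccont _ X]funext do rewrite big_nil.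
  exact: ccont_cst.
under [X in ccont _ X]funext do rewrite big_cons.
exact: (ccontD (H i) IH).
Qed.

Lemma ccont_gamma w rho : ccont w (fun u => gamma u rho 0).
Proof.
have [C1 C2] := cC1_on_gamma (R := R) rho openT.
by split; [case: (C1 w I)|case: (C2 w I)].
Qed.

(** Partial derivatives of an [R]-differentiable function are continuous, and the
    coefficients of [x_k] are linear in [gamma]. *)
Lemma ccont_Xop U F k w : R_differentiable_on U F -> U w -> ccont w (Xop a k F).
Proof.
move=> D Uw.
have cd v : coord_dir v -> ccont w (dderive F v).
  by move=> Dv; have [_ _ c1 c2] := D w Uw v Dv; exact: conj c1 c2.
rewrite /Xop; apply: ccont_sum => xi.
have cX : ccont w (d_w xi F) /\ ccont w (d_wbar xi F).
  have c1 : ccont w (dx xi F) by apply: cd; exists xi; left.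
  have c2 : ccont w (dy xi F) by apply: cd; exists xi; right.
  split; last first.
    exact: (ccontM (ccontD c1 (ccontM (ccont_cst _ _) c2)) (ccont_cst _ _)).
  rewrite (_ : d_w xi F = fun u => (dx xi F u + (- (0 +i* 1)) * dy xi F u) * 2^-1).
    exact: (ccontM (ccontD c1 (ccontM (ccont_cst _ _) c2)) (ccont_cst _ _)).
  by apply/funext => u; rewrite mulNr.
have cg (b : 'I_(n + n) -> R[i]) : ccont w (fun u => \sum_rho b rho * gamma u rho 0).
  by apply: ccont_sum => rho; exact: (ccontM (ccont_cst _ _) (ccont_gamma _ _)).
under [X in ccont _ X]funext do rewrite XcoefE conj_XcoefE.
exact: (ccontD (ccontM (cg _) cX.1) (ccontM (cg _) cX.2)).
Qed.

End Operators.

(** * Products of powers of partial integrals *)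

Section Products.
Context {R : realType} {m n N : nat}.
Variables (nu : 'I_N -> 'cV[R[i]]_(n + n)) (h : 'cV[R[i]]_N)
  (p : 'I_N -> cspace R n -> R[i]).
Implicit Types (w v : cspace R n) (U : set (cspace R n)).

(** Logarithmic differentiation: with [exp L_i = f_i] near [w], the derivative
    of [L_i] is that of [f_i] divided by [f_i], and the product is
    [exp (sum_i h_i L_i)]. *)
Lemma dderive_prod_branches w v :
  (forall i, nu_gamma (nu i) w != 0) ->
  (forall i, power_branch_at (nu_gamma (nu i)) (h i 0) (p i) w) ->
  coord_dir v ->
  dderive (prod_branches p) v w =
  \sum_i (prod_branches p w * h i 0 / nu_gamma (nu i) w) *
    dderive (nu_gamma (nu i)) v w.
Proof.
move=> f0 pb Dv.
have /choice[L HL] : forall i, exists L : cspace R n -> R[i],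
    (exists2 dL, is_cderive w v L dL & dderive (nu_gamma (nu i)) v w =
       nu_gamma (nu i) w * dL) /\
    \forall u \near w, p i u = cexp (h i 0 * L u).
  move=> i; move: (pb i); rewrite /power_branch_at (negPf (f0 i)).
  move=> [U [L [oU Uw DL HL]]]; exists L.
  have nU : \forall u \near w, U u by exact: open_nbhs_nbhs.
  split; last by apply: filterS nU => u /HL[].
  have dL := R_differentiable_cderive DL Uw Dv.
  exists (dderive L v w) => //; apply: is_cderiveE.
  have [<- _] := HL w Uw.
  apply: near_is_cderive (is_cderive_cexp dL).
  by apply: filterS nU => u /HL[].
have /choice[dL HdL] : forall i, exists dL, is_cderive w v (L i) dL /\
    dderive (nu_gamma (nu i)) v w = nu_gamma (nu i) w * dL.
  by move=> i; have [[dL ? ?] _] := HL i; exists dL.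
have nF : \forall u \near w,
    cexp (\sum_i h i 0 * L i u) = prod_branches p u.
  have : \forall u \near w, forall i, p i u = cexp (h i 0 * L i u).
    by apply: (@filter_forall _ _ _ (nbhs w)) => i; case: (HL i).
  apply: filterS => u Hu; rewrite cexp_sum; apply: eq_bigr => i _.
  by rewrite Hu.
have dF := near_is_cderive nF (is_cderive_cexp
  (is_cderive_sum (index_enum 'I_N) (fun i => is_cderiveZ (h i 0) (HdL i).1))).
rewrite (is_cderiveE dF) (nbhs_singleton nF) mulr_sumr; apply: eq_bigr => i _.
by rewrite (HdL i).2; field; exact: f0.
Qed.

(** Each factor contributes [h_i / f_i * lambda_i f_i], so the combination of
    the gradients collapses to [F * sum_i lambda_i h_i]. *)
Lemma Xop_prod_branches_eq0 (a : 'I_n -> 'I_(m + m) -> 'I_(n + n) -> R[i])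
    (lambda : 'I_N -> R[i]) k w :
  (forall i, Amx a k *m nu i = lambda i *: nu i) ->
  \sum_i lambda i * h i 0 = 0 ->
  (forall i, nu_gamma (nu i) w != 0) ->
  (forall i, power_branch_at (nu_gamma (nu i)) (h i 0) (p i) w) ->
  Xop a k (prod_branches p) w = 0.
Proof.
move=> heig hsum f0 pb.
rewrite (Xop_dderive_sum a k (fun v => @dderive_prod_branches w v f0 pb)).
transitivity (prod_branches p w * \sum_i lambda i * h i 0); last by rewrite hsum mulr0.
rewrite mulr_sumr; apply: eq_bigr => i _.
have -> : Xop a k (nu_gamma (nu i)) w = lambda i * nu_gamma (nu i) w.
  rewrite Xop_nu_gamma heig /nu_gamma mulr_sumr; apply: eq_bigr => rho _.
  by rewrite mxE mulrA.
by field; exact: f0.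
Qed.

(** At a point where some form vanishes, [x_k F] is the limit of its values
    at nearby points where none does. *)
Lemma Xop_prod_branches (a : 'I_n -> 'I_(m + m) -> 'I_(n + n) -> R[i])
    (lambda : 'I_N -> R[i]) k w :
  (forall i, nu i != 0) ->
  (forall i, Amx a k *m nu i = lambda i *: nu i) ->
  \sum_i lambda i * h i 0 = 0 ->
  integral_dom nu h p w -> Xop a k (prod_branches p) w = 0.
Proof.
move=> nu0 heig hsum [U [oU Uw DF pb]].
have [v Hv] := common_nu_gamma_neq0 nu0.
have [c1 c2] := ccont_Xop a k DF Uw.
have Z : \forall t \near (0 : R)^', Xop a k (prod_branches p) (t *: v + w) = 0.
  have nU : \forall t \near (0 : R)^', U (t *: v + w).
    by apply: (@cvg_line _ _ v w U); exact: open_nbhs_nbhs.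
  apply: filterS2 nU (near0_nu_gamma_neq0 w Hv) => t Ut f0.
  apply: (Xop_prod_branches_eq0 heig hsum f0) => i; exact: pb.
apply: complex_eqP.
  apply: (continuous_eq0_line c1 (v := v)).
  by apply: filterS Z => t; rewrite /re_part => ->.
apply: (continuous_eq0_line c2 (v := v)).
by apply: filterS Z => t; rewrite /im_part => ->.
Qed.

End Products.

(** * Existence of branches and of exponents *)

Section Existence.
Context {R : realType} {n : nat}.

Lemma ball_arcwise_connected {V : normedModType R} (w : V) (e : R) :
  arcwise_connected R (ball w e).
Proof.
move=> u v; rewrite -ball_normE /= => wu wv.
exists (fun t : R => t *: (v - u) + u); split.
- apply: continuous_subspaceT => t; apply: cvgD; last exact: cvg_cst.
  by apply: cvgZr_tmp; exact: cvg_id.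
- by rewrite scale0r add0r.
- by rewrite scale1r subrK.
- move=> t /=; rewrite in_itv /= => /andP[t0 t1].
  have -> : w - (t *: (v - u) + u) = (1 - t) *: (w - u) + t *: (w - v).
    rewrite scalerBl scale1r -addrA [- _ + _]addrC -scalerBr.
    have -> : w - v - (w - u) = - (v - u).
      by rewrite !opprB addrC addrA subrK.
    by rewrite scalerN opprD addrA addrAC.
  apply: le_lt_trans (ler_normD _ _) _.
  rewrite !normrZ (ger0_norm t0) ger0_norm ?subr_ge0 //.
  apply: (@le_lt_trans _ _ (Num.max `|w - u| `|w - v|)); last by rewrite gt_max wu wv.
  set x := `|w - u|; set y := `|w - v|; set M := Num.max x y.
  have xM : x <= M by rewrite le_max lexx.
  have yM : y <= M by rewrite le_max lexx orbT.
  by nra.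
Qed.

Lemma ball_is_domain (w : cspace R n) (e : R) : is_domain (ball w e).
Proof. by split; [exact: ball_open|exact: ball_arcwise_connected]. Qed.

(** Around a point where no form vanishes, each form has a smooth logarithm on
    the open set where its rotated value has positive real part. *)
Lemma exists_branches N (nu : 'I_N -> 'cV[R[i]]_(n + n)) (h : 'cV[R[i]]_N) :
  (forall i, nu i != 0) ->
  exists (p : 'I_N -> cspace R n -> R[i]) (Omega : set (cspace R n)),
    [/\ is_domain Omega, Omega !=set0 & Omega `<=` integral_dom nu h p].
Proof.
move=> nu0; have [w Hw] := common_nu_gamma_neq0 nu0.
have /choice[c Hc] : forall i, exists c, 0 < complex.Re (cexp (- c) * nu_gamma (nu i) w).
  by move=> i; exact: cexp_rotate.
pose f i u := cexp (- c i) * nu_gamma (nu i) u.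
have fC U i : open U -> cC1_on U (f i).
  by move=> oU; exact: (cC1_onM oU (cC1_on_cst _ oU) (cC1_on_nu_gamma _ oU)).
have : \forall u \near w, forall i, 0 < complex.Re (f i u).
  apply: (@filter_forall _ _ _ (nbhs w)) => i; have [/(_ w I)[+ _] _] := fC setT i openT.
  by move=> fc; apply: (cvgr_gt (re_part (f i) w) fc); exact: Hc.
move=> /nbhs_ballP[e /= e0 He].
(* The constant [c i] undoes the rotation, so that [cexp (L i u)] is the form itself. *)
pose L i u := c i + plog (f i u).
exists (fun i u => cexp (h i 0 * L i u)), (ball w e); split.
- exact: ball_is_domain.
- by exists w; exact: ballxx.
have oB := ball_open w e.
have LC i : cC1_on (ball w e) (L i).
  apply: (cC1_onD oB (cC1_on_cst _ oB)).
  by apply: (cC1_on_plog oB _ (fC _ i oB)) => u /He.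
have LE i u : ball w e u -> cexp (L i u) = nu_gamma (nu i) u.
  move=> Bu; rewrite /L cexpD cexp_plog; last exact: He.
  by rewrite /f mulrA -cexpD addrN cexp0 mul1r.
move=> u Bu; exists (ball w e); split => //.
- apply: cC1_on_R_differentiable; apply: (cC1_on_prod _ oB) => i.
  exact: (cC1_on_cexp oB (cC1_onM oB (cC1_on_cst _ oB) (LC i))).
- move=> {u Bu}u i Bu; rewrite /power_branch_at -(LE i u Bu) (negPf (cexp_neq0 _)).
  exists (ball w e), (L i); split => //; first exact: cC1_on_R_differentiable.
  by move=> x /(LE i) ->.
Qed.

End Existence.

(** With the unknowns indexing the rows, the matrix of the system has one more
    row than columns, so its row kernel is nonzero. *)
Lemma exists_nonzero_solution (K : fieldType) r (lambda : 'I_r -> 'I_r.+1 -> K) :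
  exists h : 'cV[K]_r.+1, h != 0 /\ forall k, \sum_i lambda k i * h i 0 = 0.
Proof.
pose M : 'M[K]_(r.+1, r) := \matrix_(i, k) lambda k i.
have K0 : kermx M != 0.
  by rewrite -mxrank_eq0 mxrank_ker subn_eq0 -ltnNge ltnS rank_leq_col.
have [j Hj] : exists j, row j (kermx M) != 0.
  apply: contrapT => H; case/eqP: K0; apply/row_matrixP => j; rewrite row0.
  by apply: contrapT => /eqP hj; apply: H; exists j.
exists (row j (kermx M))^T; split.
  by apply: contraNneq Hj => /(congr1 trmx); rewrite trmxK trmx0 => ->.
move=> k; have := congr1 (fun A => (row j A) 0 k) (mulmx_ker M).
rewrite row_mul row0 !mxE => E; rewrite -[RHS]E.
by apply: eq_bigr => i _; rewrite !mxE mulrC.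
Qed.

Theorem theorem1p1 (R : realType) (m n : nat) (hm : (0 < m)%N) (hn : (0 < n)%N)
  (a : 'I_n -> 'I_(m + m) -> 'I_(n + n) -> R[i])
  (hsolv : completely_solvable a)
  (nu : 'I_(m + m).+1 -> 'cV[R[i]]_(n + n))
  (lambda : 'I_(m + m) -> 'I_(m + m).+1 -> R[i])
  (hnu : forall theta, nu theta != 0)
  (heig : forall k theta, Amx a k *m nu theta = lambda k theta *: nu theta) :
  (exists h : 'cV[R[i]]_(m + m).+1,
     h != 0 /\ forall k, \sum_theta lambda k theta * h theta 0 = 0) /\
  forall h : 'cV[R[i]]_(m + m).+1,
    h != 0 -> (forall k, \sum_theta lambda k theta * h theta 0 = 0) ->
    (exists (p : 'I_(m + m).+1 -> cspace R n -> R[i]) (Omega : set (cspace R n)),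
       [/\ is_domain Omega, Omega !=set0 & Omega `<=` integral_dom nu h p]) /\
    (forall (p : 'I_(m + m).+1 -> cspace R n -> R[i]) (Omega : set (cspace R n)),
       is_domain Omega -> Omega `<=` integral_dom nu h p ->
       autonomous_first_integral a Omega (prod_branches p)).
Proof.
split; first exact: exists_nonzero_solution.
move=> h h0 hsum; split; first exact: exists_branches.
move=> p Omega _ sub; split.
  by move=> w /sub[U [oU Uw + _]] => /(_ w Uw).
by move=> w /sub dw k; exact: (Xop_prod_branches hnu (heig k) (hsum k) dw).
Qed.
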